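(* For $i=1,2,3$ let $G_i$ be an $r_i$-regular graph with $n_i\ge1$ vertices and $m_i$ edges, with $r_1\ge1$. Let $\theta_i$ ($1\le i\le n_1$), $\mu_j$ ($1\le j\le n_2$), $\eta_k$ ($1\le k\le n_3$) be the eigenvalues of $\mathcal L(G_1)$, $\mathcal L(G_2)$, $\mathcal L(G_3)$, respectively, each listed in non-increasing order with multiplicity (so $\theta_{n_1}=\mu_{n_2}=\eta_{n_3}=0$). Let $\mathcal G=G_1^S\bowtie(G_2^V\cup G_3^E)$ and $\mathfrak G=G_1^S\diamondsuit(G_2^V\cup G_3^E)$, and let $\tau(G)$ denote the number of spanning trees of a graph $G$. Then (1) $$\tau(\mathcal G)=\prod_{i=1}^{n_1-1}\theta_i\cdot\prod_{j=1}^{n_2-1}(r_1+r_2\mu_j)^{n_1}\cdot\prod_{k=1}^{n_3-1}(1+r_3\eta_k)^{m_1}\cdot r_1^{2n_1-1}\cdot(1+n_2)^{m_1-1}\cdot 2^{m_1-n_1-1}$$ $$\times\frac{n_3r_1r_3+4n_2r_1+2n_2r_2+2n_3r_1+4r_1}{2m_1+n_1m_2+m_1m_3+2m_1n_2+m_1n_3};$$ (2) $$\tau(\mathfrak G)=2^{2m_1-n_1-1}\cdot\prod_{i=1}^{n_1-1}(r_1+r_1n_2)\theta_i\cdot\prod_{j=1}^{n_2-1}(2+r_2\mu_j)^{m_1}\cdot\prod_{k=1}^{n_3-1}(1+r_3\eta_k)^{n_1}$$ $$\times\frac{n_2r_1r_2+4n_2r_1+2n_3r_3+4n_3+4r_1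}{2m_1+m_1m_2+n_1m_3+n_1n_3+2m_1n_2}.$$
   Context: All graphs are finite, simple and undirected. The normalized Laplacian matrix of $G$ is $\mathcal L(G)=I-D(G)^{-1/2}A(G)D(G)^{-1/2}$, where $A(G)$ is the adjacency matrix and $D(G)$ the diagonal degree matrix; rows and columns of $\mathcal L(G)$ indexed by isolated vertices are taken to be zero (e.g. $\mathcal L(K_1)=(0)$). The subdivision graph $S(G_1)$ is obtained by inserting a new vertex into every edge of $G_1$; its vertex set is $V(G_1)\cup I(G_1)$, where $I(G_1)$ is the set of inserted vertices, in bijection with the edges of $G_1$. The graph $G_1^S\bowtie(G_2^V\cup G_3^E)$ (subdivision vertex-edge neighbourhood vertex-corona) consists of $S(G_1)$, $|V(G_1)|$ copies of $G_2$ and $|I(G_1)|$ copies of $G_3$, all vertex-disjoint, where for each $i$ every neighbour in $S(G_1)$ of the $i$-th vertex of $V(G_1)$ is joined to every vertex of the $i$-th copy of $G_2$, and for each $i$ the $i$-th vertex of $I(G_1)$ is joined to every vertex of the $i$-th copy of $G_3$. The graph $G_1^S\diamondsuit(G_2^V\cup G_3^E)$ (subdivision vertex-edge neighbourhood edge-corona) consists of $S(G_1)$, $|I(G_1)|$ copies of $G_2$ and $|V(G_1)|$ copies of $G_3$, all vertex-disjoint, where for each $i$ every neighbour in $S(G_1)$ of the $i$-th vertex of $I(G_1)$ is joined to every vertex of the $i$-th copy of $G_2$, and for each $i$ the $i$-th vertex of $V(G_1)$ is joined to every vertex of the $i$-th copy of $G_3$. *)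

(* Defs.v *)
From mathcomp Require Import all_boot all_order all_algebra.

Set Implicit Arguments.
Unset Strict Implicit.
Unset Printing Implicit Defensive.

Import Order.TTheory GRing.Theory Num.Theory.
Local Open Scope ring_scope.

Record sgraph := SGraph {
  vertex :> finType;
  adj : rel vertex;
  adj_sym : symmetric adj;
  adj_irrefl : irreflexive adj }.

Section Graph.
Variable G : sgraph.

Definition degree (x : G) : nat := #|[set y | adj x y]|.

Definition regular (r : nat) : Prop := forall x : G, degree x = r.

Definition edges : {set {set G}} :=
  [set [set p.1; p.2] | p : G * G & adj p.1 p.2].

Definition edge : Type := {e : {set G} | e \in edges}.

End Graph.

Section SpanningTrees.

Definition connectedb (T : finType) (e : rel T) : bool :=
  [forall x, forall y, connect e x y].

(* A simple cycle has at most #|T| vertices, so the bound on its length loses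
   nothing: see acyclicP. Simple closed walks with at most two vertices are
   not cycles of a simple graph. *)
Definition acyclicb (T : finType) (e : rel T) : bool :=
  [forall k : 'I_#|T|.+1, forall c : k.-tuple T, (2 < k)%N ==> ~~ ucycleb e c].

Lemma acyclicP (T : finType) (e : rel T) :
  reflect (forall c : seq T, ucycle e c -> (size c <= 2)%N) (acyclicb e).
Proof.
apply: (iffP forallP) => [acy c uc | acy k].
  have lt_c : (size c < #|T|.+1)%N.
    by case/andP: (uc) => _ /card_uniqP <-; apply: max_card.
  have /forallP/(_ (in_tuple c))/implyP gt2F := acy (Ordinal lt_c).
  by rewrite leqNgt; apply/negP => /gt2F/negP; apply.
apply/forallP => c; apply/implyP => k_gt2; apply/negP => uc.
by have := acy _ uc; rewrite size_tuple leqNgt k_gt2.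
Qed.

Variable G : sgraph.

Definition edge_rel (F : {set {set G}}) : rel G :=
  [rel x y | (x != y) && ([set x; y] \in F)].

(* A spanning tree is identified with its edge set. *)
Definition is_spanning_tree (F : {set {set G}}) : bool :=
  [&& F \subset edges G, connectedb (edge_rel F) & acyclicb (edge_rel F)].

Definition num_spanning_trees : nat := #|[set F | is_spanning_tree F]|.

End SpanningTrees.

Section NormalizedLaplacian.
Variables (R : rcfType) (G : sgraph).

Definition adj_mx : 'M[R]_#|G| :=
  \matrix_(i, j) (adj (enum_val i) (enum_val j))%:R.

Definition deg_mx_invsqrt : 'M[R]_#|G| :=
  diag_mx (\row_i (Num.sqrt (degree (enum_val i))%:R)^-1).

Definition norm_laplacian : 'M[R]_#|G| :=
  \matrix_(i, j)
    if (degree (enum_val i) == 0%N) || (degree (enum_val j) == 0%N) then 0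
    else (1%:M - deg_mx_invsqrt *m adj_mx *m deg_mx_invsqrt) i j.

Definition norm_laplacian_spectrum (s : seq R) : Prop :=
  sorted (fun x y => y <= x) s /\
  char_poly norm_laplacian = \prod_(x <- s) ('X - x%:P).

End NormalizedLaplacian.

Section Subdivision.
Variable G : sgraph.

Definition subdivision_adj (x y : G + edge G) : bool :=
  match x, y with
  | inl v, inr e | inr e, inl v => v \in val e
  | _, _ => false
  end.

Lemma subdivision_adj_sym : symmetric subdivision_adj.
Proof. by case=> [v|e] [w|f]. Qed.

Lemma subdivision_adj_irrefl : irreflexive subdivision_adj.
Proof. by case. Qed.

Definition subdivision : sgraph :=
  SGraph subdivision_adj_sym subdivision_adj_irrefl.

End Subdivision.

(* The disjoint union of H, of one copy of K1 for each a : A and of one copy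
   of K2 for each b : B, in which h : H is also joined to every vertex of the
   copy a of K1 when att1 h a, and of the copy b of K2 when att2 h b. *)
Section AttachCopies.
Variables (H : sgraph) (A B : finType) (K1 K2 : sgraph).
Variables (att1 : H -> A -> bool) (att2 : H -> B -> bool).

Definition attach_adj (x y : H + A * K1 + B * K2) : bool :=
  match x, y with
  | inl (inl h), inl (inl h') => adj h h'
  | inl (inr (a, k)), inl (inr (a', k')) => (a == a') && adj k k'
  | inr (b, k), inr (b', k') => (b == b') && adj k k'
  | inl (inl h), inl (inr (a, _)) | inl (inr (a, _)), inl (inl h) => att1 h a
  | inl (inl h), inr (b, _) | inr (b, _), inl (inl h) => att2 h b
  | inl (inr _), inr _ | inr _, inl (inr _) => false
  end.

Lemma attach_adj_sym : symmetric attach_adj.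
Proof.
by case=> [[h|[a k]]|[b k]] [[h'|[a' k']]|[b' k']] //=;
  rewrite adj_sym // eq_sym.
Qed.

Lemma attach_adj_irrefl : irreflexive attach_adj.
Proof. by case=> [[h|[a k]]|[b k]] /=; rewrite adj_irrefl ?andbF. Qed.

Definition attach_copies : sgraph := SGraph attach_adj_sym attach_adj_irrefl.

End AttachCopies.

Section Coronas.
Variables G1 G2 G3 : sgraph.
Let S := subdivision G1.

Definition vertex_corona : sgraph :=
  @attach_copies S G1 (edge G1) G2 G3
    (fun s v => adj (inl v : S) s) (fun s e => s == inr e).

Definition edge_corona : sgraph :=
  @attach_copies S (edge G1) G1 G2 G3
    (fun s e => adj (inr e : S) s) (fun s v => s == inl v).

End Coronas.

(* Main.v *)
Require Import Defs.
From mathcomp Require Import all_boot all_order all_algebra.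
From mathcomp Require Import perm ring zify.

Set Implicit Arguments.
Unset Strict Implicit.
Unset Printing Implicit Defensive.

Import Order.TTheory GRing.Theory Num.Theory.
Local Open Scope ring_scope.

(** The trees are counted by a matrix-tree theorem in which the root is left
    free.  Write L for the combinatorial Laplacian, and C for any set of
    vertices.  The coefficient of 'X in det (L + 'X 1_C) is #|C| times the
    number of spanning trees ([matrix_tree]).  It comes from the forest
    expansion of det (L + diag w) ([forest_theorem]): expanding every row by
    multilinearity gives a sum over the maps sending each vertex to a neighbour
    (its parent) or to nothing (a root), and the determinant attached to such a
    map is 1 if every vertex leads to a root and 0 if some vertices are trapped
    in a cycle.  A map with the single root r is a spanning tree with its edges
    oriented towards r.

    Keeping the core C free pays off because 'X then occurs only in the block
    of C, so all the other vertices of a corona can be removed by constant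
    Schur complements.  A copy of a graph K, each of whose vertices is joined to
    the same c vertices, contributes the factor det (c + L(K)), and its Schur
    complement only involves the vector of attachments, because
    (c + L(K)) 1 = c 1 ([fdet_elim_copies]).  What is left is a matrix indexed
    by the subdivision of G1, and a last elimination leaves
      - on the edges of G1 for the vertex corona,
        'X + 2 (1 + n2) - ((1 + n2) / r1) B^T B,
      - on the vertices of G1 for the edge corona,
        'X + r1 (1 + n2) - ((1 + n2) / 2) B B^T,
    where B is the vertex-edge incidence matrix.  Sylvester's determinant
    identity ([fdet_sylvester]) moves the first one to the vertices, and
    B B^T = 2 r1 - L(G1) turns both into 'X plus a multiple of
    L(G1) = r1 times the normalized Laplacian, whose determinant is read off
    the spectrum ([fdet_spectrum_split]).  One eigenvalue, the last one since
    all are nonnegative, vanishes and provides the factor 'X; both facts about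
    the spectrum come from the forest expansion as well, at w = 0 and at
    positive constant w.

    This yields m1 tau for the vertex corona and n1 tau for the edge corona
    ([vertex_corona_trees], [edge_corona_trees]); by the handshake lemma the
    fractions of the theorem are 2 r1 / m1 and 4 / n1. *)

(** * Determinants indexed by finite types *)


Section FinDet.
Variable R : comNzRingType.

(** Avoids choosing an enumeration of the index type: the vertex sets below are
    iterated sums and products, on which matrices over ordinals are awkward. *)
Definition fdet (T : finType) (A : T -> T -> R) : R :=
  \det (\matrix_(i, j < #|T|) A (enum_val i) (enum_val j)).

Lemma eq_fdet (T : finType) (A B : T -> T -> R) : A =2 B -> fdet A = fdet B.
Proof. by move=> eAB; congr (\det _); apply/matrixP=> i j; rewrite !mxE. Qed.

Lemma fdet_bij (T : finType) n (g : 'I_n -> T) (A : T -> T -> R) :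
  bijective g -> fdet A = \det (\matrix_(i, j) A (g i) (g j)).
Proof.
move=> bg; have En : n = #|T| by rewrite -(bij_eq_card bg) card_ord.
subst n; have inj_s : injective (fun i => enum_rank (g i)).
  by move=> i j /enum_rank_inj /(bij_inj bg).
pose s := perm inj_s.
have -> : \matrix_(i, j) A (g i) (g j)
    = row_perm s (col_perm s (\matrix_(i, j) A (enum_val i) (enum_val j))).
  by apply/matrixP=> i j; rewrite !mxE !permE !enum_rankK.
rewrite row_permE col_permE !det_mulmx !det_perm odd_permV.
by rewrite mulrCA -expr2 sqrr_sign mulr1.
Qed.

Lemma fdet_reindex (T U : finType) (h : U -> T) (A : T -> T -> R) :
  bijective h -> fdet A = fdet (fun x y => A (h x) (h y)).
Proof.
move=> bh; rewrite (@fdet_bij T #|U| (fun i => h (enum_val i))) //.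
exact: bij_comp bh (enum_val_bij _).
Qed.

(** Over a ring that need not be a domain, a kernel vector forces the determinant
    to vanish as soon as one of its coordinates is 1: multiply by the adjugate. *)
Lemma fdet0 (T : finType) (A : T -> T -> R) (u : T -> R) x0 :
  (forall x, \sum_y A x y * u y = 0) -> u x0 = 1 -> fdet A = 0.
Proof.
move=> Au u1; pose v : 'cV[R]_#|T| := \col_i u (enum_val i).
set M := \matrix_(i, j < #|T|) A (enum_val i) (enum_val j).
have Mv : M *m v = 0.
  apply/matrixP=> i j; rewrite !mxE -[RHS](Au (enum_val i)).
  rewrite [RHS](reindex (@enum_val T T)) /=; last exact/onW_bij/enum_val_bij.
  by apply: eq_bigr=> k _; rewrite !mxE.
have /matrixP/(_ (enum_rank x0) 0) : \adj M *m (M *m v) = 0.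
  by rewrite Mv mulmx0.
by rewrite mulmxA mul_adj_mx mul_scalar_mx !mxE enum_rankK u1 mulr1.
Qed.

Lemma fdetE (T : finType) (A : T -> T -> R) :
  fdet A = \sum_(s : 'S_#|T|) (-1) ^+ s *
             \prod_x A x (enum_val (s (enum_rank x))).
Proof.
apply: eq_bigr => s _; congr (_ * _).
rewrite [RHS](reindex (@enum_val T T)) /=; last exact/onW_bij/enum_val_bij.
by apply: eq_bigr=> i _; rewrite mxE enum_valK.
Qed.

Definition sum_enum (T U : finType) (i : 'I_(#|T| + #|U|)) : T + U :=
  match split i with inl j => inl (enum_val j) | inr j => inr (enum_val j) end.

Lemma sum_enum_bij (T U : finType) : bijective (@sum_enum T U).
Proof.
exists (fun x => match x with
  | inl t => lshift _ (enum_rank t) | inr u => rshift _ (enum_rank u) end).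
  move=> i; rewrite /sum_enum -[RHS]splitK.
  by case: (split i) => j /=; rewrite enum_valK.
by rewrite /sum_enum; case=> [t|u];
  rewrite ?(unsplitK (inl _)) ?(unsplitK (inr _)) enum_rankK.
Qed.

Definition fmx (T U : finType) (A : T -> U -> R) : 'M[R]_(#|T|, #|U|) :=
  \matrix_(i, j) A (enum_val i) (enum_val j).

Lemma fdet_block (T U : finType) (A : T + U -> T + U -> R) :
  fdet A = \det (block_mx
     (fmx (fun t t' => A (inl t) (inl t'))) (fmx (fun t u => A (inl t) (inr u)))
     (fmx (fun u t => A (inr u) (inl t))) (fmx (fun u u' => A (inr u) (inr u')))).
Proof.
rewrite (fdet_bij _ (@sum_enum_bij T U)); congr (\det _).
apply/matrixP=> i j; rewrite !mxE /sum_enum.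
by case: splitP=> i' _; rewrite !mxE; case: splitP=> j' _; rewrite !mxE.
Qed.

Lemma fmxM (T U V : finType) (A : T -> U -> R) (B : U -> V -> R) :
  fmx A *m fmx B = fmx (fun t v => \sum_u A t u * B u v).
Proof.
apply/matrixP=> i j; rewrite !mxE.
rewrite [RHS](reindex (@enum_val U U)) /=; last exact/onW_bij/enum_val_bij.
by apply: eq_bigr=> k _; rewrite !mxE.
Qed.

(** Schur complement without inverting the eliminated block D: only a solution Z
    of D Z = C is needed, where C is the block below the diagonal.  Subtracting
    the columns of D combined by Z clears C. *)
Lemma fdet_elimr (T U : finType) (A : T + U -> T + U -> R) (Z : U -> T -> R) :
  (forall u t, \sum_u' A (inr u) (inr u') * Z u' t = A (inr u) (inl t)) ->
  fdet A =
    fdet (fun t t' => A (inl t) (inl t') - \sum_u A (inl t) (inr u) * Z u t')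
    * fdet (fun u u' => A (inr u) (inr u')).
Proof.
move=> DZ; rewrite fdet_block.
set Bul := fmx _; set Bur := fmx _; set Bdl := fmx _; set Bdr := fmx _.
pose E : 'M[R]_(#|T| + #|U|) := block_mx 1%:M 0 (- fmx Z) 1%:M.
have detE : \det E = 1 by rewrite det_lblock !det1 mulr1.
rewrite -[LHS]mulr1 -{1}detE -det_mulmx mulmx_block !mulmx0 !mulmx1 !add0r.
have -> : Bdl + Bdr *m - fmx Z = 0.
  rewrite mulmxN fmxM; apply/eqP; rewrite subr_eq0; apply/eqP.
  by apply/matrixP=> i j; rewrite !mxE DZ.
rewrite det_ublock; congr (\det _ * _).
by rewrite mulmxN fmxM; apply/matrixP=> i j; rewrite !mxE.
Qed.

Lemma fdet_eliml (T U : finType) (A : T + U -> T + U -> R) (Z : T -> U -> R) :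
  (forall t u, \sum_t' A (inl t) (inl t') * Z t' u = A (inl t) (inr u)) ->
  fdet A =
    fdet (fun u u' => A (inr u) (inr u') - \sum_t A (inr u) (inl t) * Z t u')
    * fdet (fun t t' => A (inl t) (inl t')).
Proof.
pose h (x : U + T) : T + U := match x with inl u => inr u | inr t => inl t end.
have bh : bijective h by exists (fun x =>
  match x with inl u => inr u | inr t => inl t end); case.
by move=> DZ; rewrite (fdet_reindex _ bh) (@fdet_elimr _ _ _ Z).
Qed.

Lemma fdet_ublock (T U : finType) (A : T + U -> T + U -> R) :
  (forall u t, A (inr u) (inl t) = 0) ->
  fdet A = fdet (fun t t' => A (inl t) (inl t'))
           * fdet (fun u u' => A (inr u) (inr u')).
Proof.
move=> A0; rewrite (@fdet_elimr _ _ _ (fun _ _ => 0)).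
  by congr (_ * _); apply: eq_fdet=> t t'; rewrite big1 ?subr0 // => u _;
    rewrite mulr0.
by move=> u t; rewrite A0 big1 // => u' _; rewrite mulr0.
Qed.

Lemma fdet_scalar (T : finType) (a : R) :
  fdet (fun x y : T => a *+ (x == y)) = a ^+ #|T|.
Proof.
rewrite /fdet -det_scalar; congr (\det _); apply/matrixP=> i j.
by rewrite !mxE (inj_eq enum_val_inj).
Qed.

(** Induction on the number of copies, which form a block-diagonal matrix. *)
Lemma fdet_copies (I K : finType) (M : K -> K -> R) :
  fdet (fun x y : I * K => (x.1 == y.1)%:R * M x.2 y.2) = fdet M ^+ #|I|.
Proof.
pose D (J : finType) (x y : J * K) := (x.1 == y.1)%:R * M x.2 y.2.
rewrite -/(D I); transitivity (fdet (@D 'I_#|I|)).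
  rewrite (@fdet_reindex _ _ (fun x : 'I_#|I| * K => (enum_val x.1, x.2))).
    by apply: eq_fdet=> x y; rewrite /D /= (inj_eq enum_val_inj).
  exists (fun x : I * K => (enum_rank x.1, x.2)); case=> i k /=;
    by rewrite ?enum_valK ?enum_rankK.
elim: #|I| => [|n IHn].
  rewrite expr0 /fdet; have K0 : #|{: 'I_0 * K}| = 0%N by rewrite card_prod card_ord.
  by move: (\matrix_(_, _) _); rewrite K0=> A; rewrite det_mx00.
pose h (x : K + 'I_n * K) : 'I_n.+1 * K :=
  match x with inl k => (ord0, k) | inr p => (lift ord0 p.1, p.2) end.
have bh : bijective h.
  exists (fun x : 'I_n.+1 * K => match unlift ord0 x.1 with
     | None => inl x.2 | Some i => inr (i, x.2) end).
    by case=> [k|[i k]] /=; rewrite ?unlift_none ?liftK.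
  by case=> i k /=; case: unliftP=> [j|] -> .
rewrite (fdet_reindex _ bh) fdet_ublock; last first.
  by case=> i k k'; rewrite /D /= mul0r.
rewrite exprS -IHn; congr (_ * _).
  by apply: eq_fdet=> k k'; rewrite /D /= mul1r.
Qed.

End FinDet.

Lemma fdet_morph (R S : comNzRingType) (f : {rmorphism R -> S}) (T : finType)
    (A : T -> T -> R) : fdet (fun x y => f (A x y)) = f (fdet A).
Proof.
rewrite /fdet -det_map_mx; congr (\det _).
by apply/matrixP=> i j; rewrite !mxE.
Qed.

(** * The forest expansion of the Laplacian determinant *)


Section Forests.
Variable T : finType.
Implicit Types (f : {ffun T -> option T}) (x y : T).

Definition parent f (o : option T) : option T := obind f o.

(** [None] stands for a common parent of all roots, so being a rooted forest means
    that iteration of the parent map leads everything to [None]. *)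
Definition rooted f : bool :=
  [forall x, fconnect (parent f) (Some x) None].

Lemma rooted_step f x :
  fconnect (parent f) (Some x) None = fconnect (parent f) (f x) None.
Proof.
apply/idP/idP=> [/iter_findex|]; last first.
  by apply: connect_trans; apply: connect1; rewrite /= eqxx.
case: (findex _ _ _) => [|k] //; rewrite iterSr => Ek.
by rewrite -Ek; apply: fconnect_iter.
Qed.

(** Induction from the roots towards the leaves. *)
Lemma rooted_ind f (P : T -> Prop) : rooted f ->
  (forall x, (forall y, f x = Some y -> P y) -> P x) -> forall x, P x.
Proof.
move=> /forallP rf IH x.
have := iter_findex (rf x); move: (findex _ _ _) => k.
elim: k x => [|k IHk] x //; rewrite iterSr => Ek.
by apply: IH => y fxy; apply: IHk; rewrite -fxy.
Qed.

(** Identity minus the transition matrix of the parent map; the row of a root is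
    that of the identity. *)
Definition step_mx (R : comNzRingType) f x y : R :=
  (x == y)%:R - (f x == Some y)%:R.

(** In the Leibniz formula only the identity survives: a permutation with a
    nonzero term maps each x to x or to its parent, and induction from the roots
    shows that it fixes every vertex, since it already fixes the parent. *)
Lemma fdet_rooted (R : comNzRingType) f : rooted f -> fdet (step_mx R f) = 1.
Proof.
move=> rf; have floop x : f x != Some x.
  by move: x; apply: (rooted_ind rf) => x IH; apply/eqP=> Ex; move/eqP: (IH x Ex).
rewrite fdetE (bigD1 (1%g : {perm _})) //= odd_perm1 expr0 mul1r [X in _ + X]big1 => [|s].
  rewrite addr0 big1 // => x _.
  by rewrite permE enum_rankK /step_mx eqxx (negPf (floop x)) subr0.
pose sg x := enum_val (s (enum_rank x)).
have sg_inj : injective sg by move=> x y /enum_val_inj/perm_inj/enum_rank_inj.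
case: (boolP [forall x, (sg x == x) || (f x == Some (sg x))]) => [/forallP H|].
  move/eqP=> []; apply/permP=> i; rewrite permE.
  have sgE x : sg x = x.
    move: x; apply: (rooted_ind rf) => x IH; case/orP: (H x) => /eqP // fx.
    by have /sg_inj -> := IH _ fx.
  by apply: enum_val_inj; rewrite -[RHS]sgE /sg enum_valK.
rewrite negb_forall => /existsP[x]; rewrite negb_or => /andP[n1 n2] _.
rewrite (bigD1 x) //= -/(sg x) /step_mx eq_sym (negPf n1) (negPf n2).
by rewrite subrr mul0r mulr0.
Qed.

(** The indicator of the vertices that never reach a root is a kernel vector,
    because a vertex is trapped exactly when its parent is. *)
Lemma fdet_unrooted (R : comNzRingType) f :
  ~~ rooted f -> fdet (step_mx R f) = 0.
Proof.
rewrite negb_forall => /existsP[x0 nx0].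
pose u x : R := (~~ fconnect (parent f) (Some x) None)%:R.
apply: (@fdet0 _ _ _ u x0); last by rewrite /u nx0.
move=> x; rewrite /step_mx.
under eq_bigr do rewrite mulrBl.
rewrite sumrB (bigD1 x) //= eqxx mul1r big1 => [|y]; last first.
  by rewrite eq_sym => /negPf->; rewrite mul0r.
rewrite addr0 /u rooted_step; case Ef: (f x) => [y|].
  rewrite (bigD1 y) //= eqxx mul1r big1 ?addr0 ?subrr // => z.
  by rewrite (inj_eq Some_inj) eq_sym => /negPf->; rewrite mul0r.
by rewrite connect0 sub0r big1 ?oppr0 // => y _; rewrite mul0r.
Qed.

End Forests.

Lemma sum_option (V : nmodType) (T : finType) (F : option T -> V) :
  \sum_o F o = F None + \sum_x F (Some x).
Proof.
rewrite (bigD1 None) //=; congr (_ + _).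
rewrite (reindex_omap Some id) /=; last by case.
by apply: eq_bigl => x; rewrite eqxx.
Qed.

Section Laplacian.
Variables (R : comNzRingType) (G : sgraph).
Implicit Types (f : {ffun G -> option G}).

Definition lap (x y : G) : R := (degree x)%:R *+ (x == y) - (adj x y)%:R.

Definition parent_adj f : bool :=
  [forall x, if f x is Some y then adj x y else true].

Lemma degree_sum (x : G) : (degree x)%:R = \sum_y (adj x y)%:R :> R.
Proof.
rewrite /degree -sum1_card natr_sum big_mkcond /=.
by apply: eq_bigr=> y _; rewrite inE; case: adj.
Qed.

(** Row x is a combination of rows of step matrices, one for each possible parent
    of x; this is the decomposition that multilinearity expands. *)
Lemma lap_step (w : G -> R) x y :
  lap x y + w x *+ (x == y) =
  \sum_(o : option G) (if o is Some z then (adj x z)%:R else w x)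
     * ((x == y)%:R - (o == Some y)%:R).
Proof.
rewrite sum_option /= subr0 addrC mulr_natr; congr (_ + _).
under eq_bigr do rewrite mulrBr.
rewrite sumrB -mulr_suml -degree_sum mulr_natr; congr (_ - _).
rewrite (bigD1 y) //= eqxx mulr1 big1 ?addr0 // => z.
by rewrite (inj_eq Some_inj) => /negPf->; rewrite mulr0.
Qed.

(** Maps with a parent that is not a neighbour are killed by the zero entry of the
    adjacency matrix, and maps with a cycle by [fdet_unrooted]. *)
Theorem forest_theorem (w : G -> R) :
  fdet (fun x y => lap x y + w x *+ (x == y)) =
  \sum_(f | rooted f && parent_adj f) \prod_(x | f x == None) w x.
Proof.
rewrite (eq_fdet (lap_step w)) fdetE.
pose c f x := if f x is Some z then (adj x z)%:R else w x.
transitivity (\sum_f (\prod_x c f x) * fdet (step_mx R f)).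
  under [RHS]eq_bigr do rewrite fdetE mulr_sumr.
  rewrite exchange_big /=; apply: eq_bigr=> s _.
  rewrite bigA_distr_bigA mulr_sumr; apply: eq_bigr => f _.
  by rewrite big_split /= mulrCA.
rewrite [RHS]big_mkcond /=; apply: eq_bigr=> f _.
case: (boolP (rooted f)) => [rf|/fdet_unrooted ->] /=; last by rewrite mulr0.
rewrite fdet_rooted // mulr1; case: ifP => [/forallP vf|/negbT].
  rewrite [RHS]big_mkcond /=; apply: eq_bigr=> x _; rewrite /c.
  by move: (vf x); case: (f x) => [y /= -> |].
rewrite negb_forall => /existsP[x]; case Ef: (f x) => [y|//] /negPf na.
by rewrite (bigD1 x) //= /c Ef na mul0r.
Qed.

End Laplacian.

(** * Rooted forests and spanning trees *)


Lemma set2_eqP (T : finType) (x y a b : T) :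
  [set x; y] = [set a; b] -> x = a /\ y = b \/ x = b /\ y = a.
Proof.
move=> E; have: x \in [set a; b] by rewrite -E set21.
have: y \in [set a; b] by rewrite -E set22.
have: a \in [set x; y] by rewrite E set21.
have: b \in [set x; y] by rewrite E set22.
by do 4![case/set2P=> ?]; subst; auto.
Qed.

Lemma rooted_depth (T : finType) (f : {ffun T -> option T}) : rooted f ->
  exists d : T -> nat, forall x y, f x = Some y -> (d y < d x)%N.
Proof.
move=> /forallP rf.
have H x : exists k, iter k (parent f) (Some x) == None.
  by exists (findex (parent f) (Some x) None); rewrite iter_findex.
exists (fun x => ex_minn (H x)) => x y fxy.
case: ex_minnP => i _ mini; case: ex_minnP => -[|j] //.
by rewrite iterSr /= fxy => /mini.
Qed.

Section Trees.
Variable G : sgraph.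
Implicit Types (f g : {ffun G -> option G}) (F : {set {set G}}).

Definition roots f : {set G} := [set x | f x == None].

Definition rooted_at (r : G) f : bool :=
  [&& rooted f, parent_adj f & roots f == [set r]].

Definition parent_edges f : {set {set G}} :=
  [set [set p.1; p.2] | p : G * G & f p.1 == Some p.2].

Lemma edge_relE F x y : edge_rel F x y = (x != y) && ([set x; y] \in F).
Proof. by []. Qed.

Lemma edge_rel_sym F : symmetric (edge_rel F).
Proof. by move=> x y; rewrite !edge_relE eq_sym setUC. Qed.

Lemma rooted_atP r f x : rooted_at r f -> f x = None -> x = r.
Proof.
case/and3P=> _ _ /eqP E /eqP fx; apply/set1P.
by rewrite -E inE.
Qed.

Lemma mem_parent_edges f x y :
  ([set x; y] \in parent_edges f) = (f x == Some y) || (f y == Some x).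
Proof.
apply/imsetP/orP=> [[[a b]]|].
  rewrite inE /= => fab /set2_eqP[] [-> ->]; first by left.
  by right.
by case=> fxy; [exists (x, y) | exists (y, x)]; rewrite ?inE //= setUC.
Qed.

Lemma edge_rel_parent f x y : rooted f ->
  edge_rel (parent_edges f) x y = (f x == Some y) || (f y == Some x).
Proof.
case/rooted_depth=> d Hd; rewrite edge_relE mem_parent_edges.
case: eqVneq => [->|//]; rewrite orbb /=.
by apply/esym/eqP => /Hd; rewrite ltnn.
Qed.

Lemma connected_to_root r f : rooted_at r f ->
  forall x, connect (edge_rel (parent_edges f)) x r.
Proof.
move=> rf; have rt : rooted f by case/and3P: rf.
apply: (rooted_ind rt) => x IH; case Ef: (f x) => [y|].
  apply: connect_trans (IH y Ef); apply: connect1.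
  by rewrite edge_rel_parent // Ef eqxx.
by rewrite (rooted_atP rf Ef).
Qed.

Lemma connected_parent_edges r f : rooted_at r f ->
  connectedb (edge_rel (parent_edges f)).
Proof.
move=> rf; apply/forallP=> x; apply/forallP=> y.
apply: connect_trans (connected_to_root rf x) _.
by rewrite (sym_connect_sym (edge_rel_sym _)) (connected_to_root rf).
Qed.

(** At the deepest vertex of a cycle both neighbours on the cycle would have to be
    its parent. *)
Lemma acyclic_parent_edges f : rooted f -> acyclicb (edge_rel (parent_edges f)).
Proof.
move=> rf; case: (rooted_depth rf) => d Hd.
apply/acyclicP => c; case: c => [|x0 c0] //; set c := x0 :: c0 => uc.
rewrite leqNgt; apply/negP=> sz.
have x0c : x0 \in c by rewrite mem_head.
(* x is a deepest vertex of the cycle, which is rotated to start at x. *)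
case: (arg_maxnP d x0c) => x xc maxd.
case: (rot_to xc) => i p rotE.
have {}uc : ucycle (edge_rel (parent_edges f)) (x :: p) by rewrite -rotE rot_ucycle.
have up z : z \in x :: p -> edge_rel (parent_edges f) x z -> f x = Some z.
  rewrite -rotE mem_rot => zc; rewrite edge_rel_parent //.
  case/orP=> /eqP // /Hd; rewrite ltnNge => /negP[]; exact: maxd.
have szp : (1 < size p)%N.
  by rewrite -ltnS -[(size p).+1]/(size (x :: p)) -rotE size_rot.
case: p => [|y [|z p]] // in uc up rotE szp *.
case/andP: uc; rewrite /cycle rcons_path => /andP[/= /andP[xy _] lx].
case/and3P=> _ yN _.
have fy : f x = Some y by apply: up; rewrite ?inE ?eqxx ?orbT.
have fl : f x = Some (last z p).
  apply: up; last by rewrite edge_rel_sym.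
  by rewrite in_cons in_cons mem_last !orbT.
by move: yN; rewrite fy in fl; case: fl => ->; rewrite mem_last.
Qed.

Lemma parent_edges_tree r f : rooted_at r f -> is_spanning_tree (parent_edges f).
Proof.
move=> rf; case/and3P: (rf) => rt va _; apply/and3P; split.
- apply/subsetP=> e /imsetP[[x y]]; rewrite inE /= => /eqP fxy ->.
  apply/imsetP; exists (x, y) => //; rewrite inE /=.
  by move/forallP: va => /(_ x); rewrite fxy.
- exact: connected_parent_edges rf.
- exact: acyclic_parent_edges.
Qed.

(** If f and g have the same edges and g x = y, then f x = y or f y = x.  The
    latter would give g y = x, as f and g agree at y by induction from the root,
    and x and y would be parents of each other. *)
Lemma parent_edges_inj r : {in rooted_at r &, injective parent_edges}.
Proof.
move=> f g rf rg E; apply/ffunP.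
have [rt vg rg'] := and3P rg; case: (rooted_depth rt) => d Hd.
apply: (rooted_ind rt) => x IH; case Eg: (g x) => [y|]; last first.
  have: x \in roots f; last by rewrite inE => /eqP.
  have [_ _ /eqP->] := and3P rf.
  by rewrite (rooted_atP rg Eg) set11.
have: [set x; y] \in parent_edges f by rewrite E mem_parent_edges Eg eqxx.
rewrite mem_parent_edges => /orP[/eqP // | /eqP fy].
by have := Hd _ _ Eg; rewrite ltnNge ltnW // Hd // -IH.
Qed.

(** The parent of a vertex is a neighbour closer to r.  An edge of F outside the
    resulting tree would close a cycle of F with the path that joins its
    endpoints in that tree. *)
Lemma tree_parents r F : is_spanning_tree F ->
  exists2 f, rooted_at r f & F = parent_edges f.
Proof.
case/and3P=> /subsetP FE /forallP conn /acyclicP acy.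
set e := edge_rel F in conn acy.
have H x : exists k, [exists p : k.-tuple G, path e x p && (last x p == r)].
  have /connectP[p pp lp] := forallP (conn x) r.
  by exists (size p); apply/existsP; exists (in_tuple p); rewrite pp /= -lp eqxx.
pose d x := ex_minn (H x).
have near x : x != r -> exists2 y, e x y & (d y < d x)%N.
  rewrite {2}/d; case: ex_minnP => k /existsP[p /andP[]] pp lp _ nxr.
  case: k p pp lp => [|k] p.
    by rewrite (tuple0 p) /= => _ /eqP xr; rewrite xr eqxx in nxr.
  case/tupleP: p => y p /= /andP[exy pp] lp; exists y => //.
  rewrite /d; case: ex_minnP => i _ mini; rewrite ltnS; apply: mini.
  by apply/existsP; exists p; rewrite pp.
pose f := [ffun x => if x == r then None else [pick y | e x y && (d y < d x)%N]].
have fE x y : f x = Some y -> e x y /\ (d y < d x)%N.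
  by rewrite ffunE; case: ifP => // _; case: pickP => // z /andP[? ?] [<-].
have f0 x : (f x == None) = (x == r).
  rewrite ffunE; case: ifP => [//|/negbT nxr]; case: pickP => // n.
  by case: (near x nxr) => y exy dy; move: (n y); rewrite exy dy.
have rf : rooted_at r f.
  apply/and3P; split.
  - apply/forallP=> x; have [n le_n] := ubnP (d x).
    elim: n x le_n => // n IHn x le_n; rewrite rooted_step.
    case Ef: (f x) => [y|]; last exact: connect0.
    by apply: IHn; apply: leq_trans (proj2 (fE _ _ Ef)) _.
  - apply/forallP=> x; case Ef: (f x) => [y|//].
    have [/andP[_ /FE /imsetP[[a b]]]] := fE _ _ Ef.
    by rewrite inE /= => ab /set2_eqP[] [-> ->] _ //; rewrite adj_sym.
  - by apply/eqP/setP=> x; rewrite !inE.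
exists f => //; apply/eqP; rewrite eqEsubset; apply/andP; split; last first.
  apply/subsetP=> s /imsetP[[x y]]; rewrite inE /= => /eqP fxy ->.
  by have [/andP[]] := fE _ _ fxy.
have sub : subrel (edge_rel (parent_edges f)) e.
  have rt : rooted f by case/and3P: rf.
  move=> x y; rewrite edge_rel_parent // => /orP[] /eqP /fE[] //.
  by rewrite /e edge_rel_sym.
apply/subsetP=> s sF; have /imsetP[[x y]] := FE _ sF.
rewrite inE /= => axy sE; rewrite sE in sF *.
have nxy : x != y by apply: contraTneq axy => ->; rewrite adj_irrefl.
have /forallP/(_ x)/forallP/(_ y) := connected_parent_edges rf.
case/connectP=> p0 pp0 lp0; case/shortenP: pp0 lp0 => p pp up _ lp.
apply: contraT => nin.
(* The path avoids the edge joining its endpoints, so it has length at least 2. *)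
have szp : (1 < size p)%N.
  case: p pp lp {up} => [|z [|z' p]] //= pp zy; first by rewrite zy eqxx in nxy.
  by move: pp; rewrite -zy andbT => /andP[_]; rewrite (negPf nin).
have: (size (x :: p) <= 2)%N.
  apply: acy; rewrite /ucycle up andbT /cycle rcons_path (sub_path sub pp) -lp.
  by rewrite /e edge_relE eq_sym nxy setUC.
by rewrite /= ltnNge szp.
Qed.

Theorem card_rooted_at r : #|[set f | rooted_at r f]| = num_spanning_trees G.
Proof.
rewrite -(card_in_imset (f := parent_edges)).
  apply: eq_card=> F; rewrite inE; apply/imsetP/idP => [[f]|/(tree_parents r)[f rf ->]].
    by rewrite inE => rf ->; apply: parent_edges_tree rf.
  by exists f; rewrite // inE.
by move=> f g; rewrite !inE; apply: parent_edges_inj.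
Qed.

(** A forest with k roots, all in C, contributes 'X^k, and there is no forest
    without roots; the coefficient of 'X counts the trees rooted in C. *)
Theorem matrix_tree (R : comNzRingType) (C : pred G) :
  (fdet (fun x y : G => lap {poly R} x y + (if C x then 'X else 0) *+ (x == y)))`_1
  = (#|C| * num_spanning_trees G)%:R.
Proof.
rewrite forest_theorem coef_sum.
transitivity (\sum_(f | rooted f && parent_adj f)
    \sum_(r in C) (roots f == [set r])%:R : R).
  apply: eq_bigr => f _.
  have -> : \prod_(x | f x == None) (if C x then 'X else 0 : {poly R})
      = if roots f \subset C then 'X^#|roots f| else 0.
    case: ifP => [/subsetP sC|/negbT/subsetPn[x]].
      rewrite -prodr_const; apply: eq_big => [x|x fx]; first by rewrite inE.
      by rewrite ifT //; apply: sC; rewrite inE.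
    by rewrite inE => fx nC; rewrite (bigD1 x) //= ifF ?mul0r //; apply/negbTE.
  case: (boolP (#|roots f| == 1%N)) => [/cards1P[r rE]|n1].
    have -> : (roots f \subset C) = (r \in C).
      rewrite rE; apply/subsetP/idP => [-> //|rC x /set1P-> //].
      by rewrite set11.
    rewrite rE cards1; case: ifP => rC.
      rewrite coefX (bigD1 r) //= eqxx big1 ?addr0 // => s /andP[_ nsr].
      by rewrite (inj_eq set1_inj) eq_sym (negPf nsr).
    rewrite coef0 big1 // => s sC; rewrite (inj_eq set1_inj).
    by case: eqP => // rs; rewrite rs sC in rC.
  rewrite big1 => [|r _]; last by case: eqP => // E; rewrite E cards1 in n1.
  by case: ifP; rewrite ?coef0 // coefXn eq_sym (negPf n1).
rewrite exchange_big /= natrM mulr_natl -sumr_const; apply: eq_bigr => r _.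
rewrite -(card_rooted_at r) -sum1_card natr_sum [RHS]big_mkcond /=.
rewrite [LHS]big_mkcond /=; apply: eq_bigr => f _; rewrite inE /rooted_at.
by case: (rooted f); case: (parent_adj f); case: eqP.
Qed.
End Trees.

(** A rooted forest on a nonempty vertex set has at least one root, so every term
    of the forest expansion contains a zero weight. *)
Lemma fdet_lap0 (R : comNzRingType) (G : sgraph) :
  (0 < #|G|)%N -> fdet (@lap R G) = 0.
Proof.
case/card_gt0P=> x0 _.
rewrite (@eq_fdet _ _ _ (fun x y : G => lap R x y + 0 *+ (x == y))); last first.
  by move=> x y; rewrite mul0rn addr0.
rewrite forest_theorem big1 // => f /andP[rf _].
case: (pickP [pred x | f x == None]) => [x fx|nof].
  by rewrite (bigD1 x) //= mul0r.
have [] : False; move: (x0); apply: (rooted_ind rf) => x IH.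
by move: (nof x) => /=; case Ef: (f x) => [y|//] _; apply: IH Ef.
Qed.

(** All terms of the forest expansion are nonnegative, and the forest in which
    every vertex is a root contributes a power of c. *)
Lemma fdet_lap_gt0 (R : realFieldType) (G : sgraph) (c : R) :
  0 < c -> 0 < fdet (fun x y : G => lap R x y + c *+ (x == y)).
Proof.
move=> c0; rewrite forest_theorem.
pose f0 : {ffun G -> option G} := [ffun=> None].
have f0r : rooted f0 && parent_adj f0.
  apply/andP; split; apply/forallP=> x; rewrite ?ffunE //.
  by rewrite rooted_step ffunE.
rewrite (bigD1 f0) //= ltr_pwDl //; first by rewrite prodr_gt0.
by apply: sumr_ge0 => f _; apply: prodr_ge0 => x _; apply: ltW.
Qed.

(** * Incidence and the Laplacian spectrum of a regular graph *)


Section Incidence.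
Variables (R : comNzRingType) (G : sgraph).
Implicit Types (v : G).

Lemma card_edge : #|{: edge G}| = #|edges G|.
Proof. by rewrite card_sig; apply: eq_card=> e; rewrite inE. Qed.

Lemma sum_endpoints (e : edge G) : \sum_v (v \in val e)%:R = 2 :> R.
Proof.
rewrite -natr_sum -big_mkcond /= sum1_card; congr (_%:R).
case: e => e /= /imsetP[[x y]]; rewrite inE /= => xy ->.
by rewrite cards2; case: eqVneq xy => // ->; rewrite adj_irrefl.
Qed.

(** The edges at v correspond to the neighbours of v. *)
Lemma sum_incident (F : {set G} -> R) v :
  \sum_(e : edge G) (v \in val e)%:R * F (val e) = \sum_y (adj v y)%:R * F [set v; y].
Proof.
transitivity (\sum_(e in edges G) (v \in e)%:R * F e).
  by rewrite (big_sub (mem (edges G))).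
have inj_v : {in [pred y | adj v y] &, injective (fun y => [set v; y])}.
  by move=> y z _ _ /set2_eqP[] [] // -> ->.
have edgesE (e : {set G}) : (e \in [set [set v; y] | y in [pred y | adj v y]])
    = (e \in edges G) && (v \in e).
  apply/imsetP/andP=> [[y]|[/imsetP[[x y]]]].
    rewrite inE => vy ->; rewrite set21; split=> //.
    by apply/imsetP; exists (v, y); rewrite ?inE.
  rewrite inE /= => xy -> /set2P[] ->; first by exists y; rewrite ?inE.
  by exists x; rewrite ?inE 1?adj_sym // setUC.
transitivity (\sum_(y in [pred y | adj v y]) F [set v; y]); last first.
  rewrite big_mkcond; apply: eq_bigr => y _; rewrite inE.
  by case: adj; rewrite ?mul1r ?mul0r.
rewrite -(big_imset (fun e : {set G} => F e)) //=.
under [RHS]eq_bigl do rewrite edgesE.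
rewrite [RHS]big_mkcondr /=; apply: eq_bigr => e _.
by case: (v \in e); rewrite ?mul1r ?mul0r.
Qed.

Lemma sum_incident2 v w :
  \sum_(e : edge G) (v \in val e)%:R * (w \in val e)%:R =
  (degree v)%:R *+ (v == w) + (adj v w)%:R :> R.
Proof.
rewrite (sum_incident (fun e => (w \in e)%:R)).
case: eqVneq => [->|nvw].
  rewrite adj_irrefl addr0 mulr1n degree_sum; apply: eq_bigr => y _.
  by rewrite set21 mulr1.
rewrite mulr0n add0r (bigD1 w) //= set22 mulr1 big1 ?addr0 // => y nyw.
by rewrite !inE eq_sym (negPf nvw) eq_sym (negPf nyw) mulr0.
Qed.

Lemma sum_incident1 v : \sum_(e : edge G) (v \in val e)%:R = (degree v)%:R :> R.
Proof.
have := sum_incident (fun=> 1) v; rewrite degree_sum.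
by under eq_bigr do rewrite mulr1; move->; apply: eq_bigr => y _; rewrite mulr1.
Qed.

End Incidence.

Lemma handshake (G : sgraph) r : regular G r -> (2 * #|edges G| = #|G| * r)%N.
Proof.
move=> reg; apply/eqP; rewrite -(eqr_nat int); apply/eqP.
transitivity (\sum_(e : edge G) \sum_v (v \in val e)%:R : int).
  under eq_bigr do rewrite sum_endpoints.
  by rewrite sumr_const -card_edge natrM mulr_natr.
rewrite exchange_big /= natrM mulr_natl -sumr_const; apply: eq_bigr => v _.
by rewrite sum_incident1 reg.
Qed.

Section Spectrum.
Variables (R : rcfType) (G : sgraph) (r : nat).
Hypothesis reg : regular G r.

Lemma lap_morph (P S : comNzRingType) (f : {rmorphism P -> S}) (x y : G) :
  f (lap P x y) = lap S x y.
Proof. by rewrite /lap rmorphB rmorphMn !rmorph_nat. Qed.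

Lemma lap_regular (i j : 'I_#|G|) :
  lap R (enum_val i) (enum_val j) = r%:R * norm_laplacian R G i j.
Proof.
rewrite mxE !reg orbb; case: eqVneq => [r0|r_n0].
  rewrite mulr0 /lap reg r0 mul0rn sub0r.
  have := reg (enum_val i); rewrite r0 => /eqP; rewrite cards_eq0 => /eqP/setP.
  by move=> /(_ (enum_val j)); rewrite !inE => ->; rewrite oppr0.
rewrite /deg_mx_invsqrt mul_diag_mx mul_mx_diag !mxE !reg /lap reg (inj_eq enum_val_inj).
have sr : Num.sqrt r%:R * Num.sqrt r%:R = r%:R :> R.
  by rewrite -expr2 sqr_sqrtr // ler0n.
have s_n0 : Num.sqrt r%:R != 0 :> R by rewrite sqrtr_eq0 -ltNge ltr0n lt0n.
move: (Num.sqrt r%:R) sr s_n0 => q <- q0; case: (i == j); case: adj;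
  rewrite ?mulr1n ?mulr0n; by field.
Qed.

Variable s : seq R.
Hypothesis hs : norm_laplacian_spectrum G s.

Lemma size_spectrum : size s = #|G|.
Proof.
have := size_char_poly (norm_laplacian R G).
by rewrite (proj2 hs) size_prod_XsubC => -[].
Qed.

(** The characteristic polynomial of the normalized Laplacian, composed with
    - p / (b r) and rescaled when b r is nonzero; p is a polynomial so that the
    variable that marks the core can be part of it. *)
Lemma fdet_spectrum (p : {poly R}) (b : R) :
  fdet (fun x y : G => p *+ (x == y) + b%:P * lap {poly R} x y) =
  \prod_(x <- s) (p + (b * r%:R * x)%:P).
Proof.
have lapM := lap_regular; have [_ sM] := hs; have size_s := size_spectrum.
move: (norm_laplacian R G) => M in lapM sM *; set c := b * r%:R.
have -> : fdet (fun x y : G => p *+ (x == y) + b%:P * lap {poly R} x y) =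
          \det (p%:M + c%:P *: map_mx polyC M).
  rewrite /fdet; congr (\det _); apply/matrixP=> i j; rewrite !mxE (inj_eq enum_val_inj).
  by rewrite -(lap_morph polyC) lapM -!polyCM mulrA.
case: (eqVneq c 0) => [->|c0].
  rewrite scale0r addr0 det_scalar -size_s.
  under eq_bigr do rewrite mul0r addr0.
  by rewrite big_const_seq count_predT iter_mulr_1.
pose q := (- c^-1)%:P * p.
have -> : p%:M + c%:P *: map_mx polyC M = (- c)%:P *: (q%:M - map_mx polyC M).
  rewrite scalerBr scale_scalar_mx /q mulrA -polyCM mulrNN mulfV // mul1r.
  by rewrite polyCN scaleNr opprK.
rewrite detZ.
have -> : \det (q%:M - map_mx polyC M) = char_poly M \Po q.
  rewrite -[RHS](det_map_mx (comp_poly q)); congr (\det _).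
  apply/matrixP=> i j; rewrite !mxE rmorphB rmorphMn /= comp_polyX.
  by rewrite comp_polyC.
rewrite sM rmorph_prod /= -size_s.
rewrite -[X in _ ^+ X]count_predT -iter_mulr_1 -big_const_seq -big_split /=.
apply: eq_bigr => x _; rewrite rmorphB /= comp_polyX comp_polyC mulrBr /q.
rewrite mulrA -!polyCM mulrNN mulfV // mul1r; congr (_ + _).
by rewrite mulNr polyCN opprK.
Qed.

Lemma fdet_lap_spectrum (c : R) :
  fdet (fun x y : G => lap R x y + c *+ (x == y)) =
  \prod_(x <- s) (c + r%:R * x).
Proof.
apply: polyC_inj; rewrite -(fdet_morph polyC) rmorph_prod /=.
rewrite -[RHS]/(\prod_(x <- s) (c + r%:R * x)%:P).
under [RHS]eq_bigr do rewrite polyCD -[r%:R]mul1r.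
rewrite -fdet_spectrum; apply: eq_fdet => x y.
by rewrite rmorphD /= (lap_morph polyC) polyCMn mul1r addrC.
Qed.

(** A negative r x would make det (L + c) vanish at the positive c = - r x. *)
Lemma spectrum_ge0 x : x \in s -> 0 <= r%:R * x.
Proof.
move=> xs; rewrite leNgt; apply/negP => lt0.
have := fdet_lap_gt0 G (c := - (r%:R * x)); rewrite oppr_gt0 fdet_lap_spectrum.
by move/(_ lt0); rewrite (big_rem x) //= addNr mul0r ltxx.
Qed.

(** Multiplying by r covers the edgeless case r = 0, where the normalized Laplacian
    is zero by convention. *)
Lemma spectrum_last : (0 < #|G|)%N -> r%:R * s`_(#|G|.-1) = 0.
Proof.
move=> n0; case: (posnP r) => [->|r0]; first by rewrite mul0r.
have /eqP := fdet_lap0 R n0.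
rewrite (@eq_fdet _ _ _ (fun x y : G => lap R x y + 0 *+ (x == y))); last first.
  by move=> x y; rewrite mul0rn addr0.
rewrite fdet_lap_spectrum prodf_seq_eq0 => /hasP[x xs /=].
rewrite add0r mulf_eq0 pnatr_eq0 -[r == 0%N]negbK -lt0n r0 /= => /eqP x0.
apply/le_anti; rewrite spectrum_ge0 ?mem_nth ?size_spectrum ?prednK // andbT.
rewrite pmulr_rle0 ?ltr0n // -{2}x0 -(nth_index 0 xs).
have geT : transitive (fun x y : R => y <= x).
  by move=> a b c ba ac; apply: le_trans ac ba.
have mono := sorted_leq_nth geT (@lexx _ R) 0 (proj1 hs).
apply: mono.
- by rewrite inE index_mem.
- by rewrite inE size_spectrum prednK.
- by rewrite -ltnS prednK // -size_spectrum index_mem.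
Qed.

Lemma fdet_spectrum_split (p : {poly R}) (b : R) : (0 < #|G|)%N ->
  fdet (fun x y : G => p *+ (x == y) + b%:P * lap {poly R} x y) =
  p * \prod_(i < #|G| - 1) (p + (b * r%:R * s`_i)%:P).
Proof.
move=> n0; rewrite fdet_spectrum (big_nth 0) big_mkord size_spectrum subn1.
have := spectrum_last n0; case: #|G| n0 => // n _ /= r0.
by rewrite big_ord_recr /= -mulrA r0 mulr0 addr0 mulrC.
Qed.

End Spectrum.

(** * Attaching copies of graphs *)


Lemma sum_lap (R : comNzRingType) (G : sgraph) (x : G) : \sum_y lap R x y = 0.
Proof.
rewrite sumrB -degree_sum (bigD1 x) //= eqxx big1 ?addr0 ?subrr // => y.
by rewrite eq_sym => /negPf->.
Qed.

Lemma sum_pair_eq (R : pzSemiRingType) (I K : finType) (i : I) (F : I -> K -> R) :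
  \sum_(q : I * K) (i == q.1)%:R * F q.1 q.2 = \sum_k F i k.
Proof.
rewrite -(pair_bigA _ (fun j k => (i == j)%:R * F j k)) /= (bigD1 i) //=.
rewrite [X in _ + X]big1 => [|j]; last first.
  by rewrite eq_sym => /negPf nij; rewrite big1 // => k _; rewrite nij mul0r.
by rewrite addr0; apply: eq_bigr => k _; rewrite eqxx mul1r.
Qed.

Lemma inl_eqE (T U : eqType) (x y : T) : (inl x == inl y :> T + U) = (x == y).
Proof. by []. Qed.

Lemma inr_eqE (T U : eqType) (x y : U) : (inr x == inr y :> T + U) = (x == y).
Proof. by []. Qed.

Lemma sum_pair_fst (R : pzSemiRingType) (I K : finType) (F : I -> R) :
  \sum_(q : I * K) F q.1 = #|K|%:R * \sum_i F i.
Proof.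
rewrite -(pair_bigA _ (fun i (k : K) => F i)) mulr_sumr.
by apply: eq_bigr => i _; rewrite sumr_const mulr_natl.
Qed.

(** The matrix Z required by [fdet_elimr] is explicit, since each row of the
    Laplacian of K sums to zero and so c + L(K) multiplies by c the functions
    that are constant on copies. *)
Lemma fdet_elim_copies (R : comUnitRingType) (T I : finType) (K : sgraph)
    (A : T + I * K -> T + I * K -> R) (att : T -> I -> R) (c : R) :
  c \is a GRing.unit ->
  (forall p q, A (inr p) (inr q) =
     (p.1 == q.1)%:R * (c *+ (p.2 == q.2) + lap R p.2 q.2)) ->
  (forall p t, A (inr p) (inl t) = - att t p.1) ->
  (forall p t, A (inl t) (inr p) = - att t p.1) ->
  fdet A = fdet (fun t t' => A (inl t) (inl t')
                  - #|K|%:R * c^-1 * \sum_i att t i * att t' i)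
           * fdet (fun x y : K => c *+ (x == y) + lap R x y) ^+ #|I|.
Proof.
move=> cU Arr Arl Alr.
rewrite (@fdet_elimr _ _ _ _ (fun p t => - (c^-1 * att t p.1))); last first.
  move=> [i k] t; rewrite Arl /=.
  under eq_bigr do rewrite Arr /= -mulrA.
  rewrite (sum_pair_eq i (fun j k' => (c *+ (k == k') + lap R k k')
                               * - (c^-1 * att t j))) /=.
  rewrite -mulr_suml big_split /= sum_lap addr0 (bigD1 k) //= eqxx big1.
    by rewrite addr0 mulr1n mulrN mulVKr.
  by move=> j; rewrite eq_sym => /negPf->.
congr (_ * _).
  apply: eq_fdet => t t'; congr (_ - _).
  under eq_bigr do rewrite Alr mulrNN.
  rewrite (sum_pair_fst _ (fun i => att t i * (c^-1 * att t' i))) -[RHS]mulrA.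
  by congr (_ * _); rewrite mulr_sumr; apply: eq_bigr => i _; rewrite mulrCA.
rewrite -fdet_copies; exact: eq_fdet.
Qed.

Section Attach.
Variables (H : sgraph) (A B : finType) (K1 K2 : sgraph).
Variables (att1 : H -> A -> bool) (att2 : H -> B -> bool).
Variables (R : numFieldType) (c1 c2 : nat) (w : H -> {poly R}).
Hypothesis c1_gt0 : (0 < c1)%N.
Hypothesis c2_gt0 : (0 < c2)%N.
Hypothesis card_att1 : forall a, #|[pred h | att1 h a]| = c1.
Hypothesis card_att2 : forall b, #|[pred h | att2 h b]| = c2.
Let P := {poly R}.
Let X := attach_copies K1 K2 att1 att2.

Lemma sum_att1 a : \sum_h (att1 h a)%:R = c1%:R :> P.
Proof.
rewrite -(card_att1 a) -sum1_card natr_sum [RHS]big_mkcond /=.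
by apply: eq_bigr => h _; rewrite inE; case: att1.
Qed.

Lemma sum_att2 b : \sum_h (att2 h b)%:R = c2%:R :> P.
Proof.
rewrite -(card_att2 b) -sum1_card natr_sum [RHS]big_mkcond /=.
by apply: eq_bigr => h _; rewrite inE; case: att2.
Qed.

Lemma degree_core (h : H) : (@degree X (inl (inl h)))%:R =
  (degree h)%:R + #|K1|%:R * (\sum_a (att1 h a)%:R)
    + #|K2|%:R * \sum_b (att2 h b)%:R :> P.
Proof.
rewrite degree_sum 2!big_sumType /= -degree_sum -!addrA; congr (_ + _).
by congr (_ + _); rewrite -sum_pair_fst; apply: eq_bigr => -[].
Qed.

Lemma degree_copy1 a (k : K1) :
  (@degree X (inl (inr (a, k))))%:R = c1%:R + (degree k)%:R :> P.
Proof.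
rewrite degree_sum 2!big_sumType /= sum_att1 [X in _ + X]big1 // addr0.
congr (_ + _); rewrite degree_sum -(sum_pair_eq a (fun _ l => (adj k l)%:R)).
by apply: eq_bigr => -[b l] _ /=; rewrite -natrM mulnb.
Qed.

Lemma degree_copy2 b (k : K2) :
  (@degree X (inr (b, k)))%:R = c2%:R + (degree k)%:R :> P.
Proof.
rewrite degree_sum 2!big_sumType /= sum_att2 [X in _ + X + _]big1; last first.
  by case.
rewrite addr0 degree_sum -(sum_pair_eq b (fun _ l => (adj k l)%:R)).
by congr (_ + _); apply: eq_bigr => -[a l] _ /=; rewrite -natrM mulnb.
Qed.

(** The Schur complement, on the vertices of H, of the two families of copies. *)
Definition core_mx (h h' : H) : P :=
  lap P h h' + (w h + #|K1|%:R * (\sum_a (att1 h a)%:R)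
                    + #|K2|%:R * \sum_b (att2 h b)%:R) *+ (h == h')
  - #|K1|%:R * c1%:R^-1 * (\sum_a (att1 h a)%:R * (att1 h' a)%:R)
  - #|K2|%:R * c2%:R^-1 * (\sum_b (att2 h b)%:R * (att2 h' b)%:R).

Lemma natr_poly_unit n : (0 < n)%N -> (n%:R : P) \is a GRing.unit.
Proof.
by move=> n0; rewrite -[_%:R](rmorph_nat polyC) poly_unitE size_polyC coefC
  eqxx unitfE pnatr_eq0 -lt0n n0.
Qed.

Lemma fdet_attach :
  fdet (fun x y : X => lap P x y
     + (if x is inl (inl h) then w h else 0) *+ (x == y)) =
  fdet core_mx * fdet (fun x y : K1 => c1%:R *+ (x == y) + lap P x y) ^+ #|A|
   * fdet (fun x y : K2 => c2%:R *+ (x == y) + lap P x y) ^+ #|B|.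
Proof.
rewrite (@fdet_elim_copies _ _ _ _ _
  (fun t b => if t is inl h then (att2 h b)%:R else 0) c2%:R); first last.
- by case=> b k [h|[a l]]; rewrite /lap /= addr0 sub0r ?oppr0.
- by case=> b k [h|[a l]]; rewrite /lap /= mul0rn addr0 sub0r ?oppr0.
- case=> a k [b l] /=; rewrite mul0rn addr0 /lap degree_copy2 /=.
  by rewrite inr_eqE xpair_eqE; case: eqP => _;
    rewrite ?mul0r ?mul1r ?mulr0n ?subr0 //= mulrnDl addrA.
- exact: natr_poly_unit.
congr (_ * _).
rewrite (@fdet_elim_copies _ _ _ _ _ (fun h a => (att1 h a)%:R) c1%:R); first last.
- case=> a k h; rewrite /lap /= big1 ?mulr0 ?subr0 ?addr0 ?sub0r // => b _.
  by rewrite mulr0.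
- case=> a k h; rewrite /lap /= big1 => [|b _]; last by rewrite mul0r.
  by rewrite mulr0 subr0 mul0rn addr0 sub0r.
- case=> a k [b l] /=; rewrite big1 => [|? _]; last by rewrite mul0r.
  rewrite mulr0 subr0 mul0rn addr0 /lap degree_copy1 /=.
  by rewrite inl_eqE inr_eqE xpair_eqE; case: eqP => _;
    rewrite ?mul0r ?mul1r ?mulr0n ?subr0 //= mulrnDl addrA.
- exact: natr_poly_unit.
congr (_ * _); apply: eq_fdet => h h'.
rewrite /core_mx /lap degree_core /=.
rewrite !inl_eqE.
rewrite !mulrnDl; ring.
Qed.

End Attach.

(** * The two coronas *)


Lemma fdet_tr (R : comNzRingType) (T : finType) (A : T -> T -> R) :
  fdet (fun x y => A y x) = fdet A.
Proof.
by rewrite /fdet -det_tr; congr (\det _); apply/matrixP => i j; rewrite !mxE.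
Qed.

Lemma sum_delta (R : pzSemiRingType) (T : finType) (x : T) (a : R) (F : T -> R) :
  \sum_y (a *+ (x == y)) * F y = a * F x.
Proof.
rewrite (bigD1 x) //= eqxx big1 ?addr0 // => y.
by rewrite eq_sym => /negPf->; rewrite mul0r.
Qed.

(** Both sides are the determinant of the block matrix with scalar diagonal blocks
    a, off-diagonal blocks a b B and B^T, from which either family of rows can be
    eliminated.  No division by a is involved. *)
Lemma fdet_sylvester (R : comNzRingType) (T U : finType) (B : T -> U -> R) a b :
  a ^+ #|T| * fdet (fun u u' => a *+ (u == u') - b * \sum_t B t u * B t u') =
  a ^+ #|U| * fdet (fun t t' => a *+ (t == t') - b * \sum_u B t u * B t' u).
Proof.
pose M (x y : T + U) : R := match x, y with
  | inl t, inl t' => a *+ (t == t')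
  | inr u, inr u' => a *+ (u == u')
  | inl t, inr u => a * (b * B t u)
  | inr u, inl t => B t u end.
transitivity (fdet M).
  rewrite (@fdet_eliml _ _ _ _ (fun t u => b * B t u)) => [|t u]; last first.
    exact: sum_delta.
  rewrite fdet_scalar mulrC; congr (_ * _); apply: eq_fdet => u u' /=.
  by rewrite mulr_sumr; congr (_ - _); apply: eq_bigr => t _; rewrite mulrCA.
rewrite -fdet_tr (@fdet_elimr _ _ _ _ (fun u t => b * B t u)) => [|u t].
  rewrite /= (@eq_fdet _ _ (fun u u' : U => a *+ (u' == u))
    (fun u u' => a *+ (u == u'))); last by move=> u u'; rewrite eq_sym.
  rewrite fdet_scalar mulrC; congr (_ * _); apply: eq_fdet => t t' /=.
  rewrite eq_sym mulr_sumr; congr (_ - _); apply: eq_bigr => u _.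
  by rewrite mulrCA.
rewrite /= -(sum_delta u a (fun u' => b * B t u')).
by apply: eq_bigr => u' _; rewrite eq_sym.
Qed.

Section Coronas.
Variables (R : rcfType) (G1 G2 G3 : sgraph) (r1 r2 r3 : nat).
Hypothesis n1_gt0 : (0 < #|G1|)%N.
Hypothesis n2_gt0 : (0 < #|G2|)%N.
Hypothesis n3_gt0 : (0 < #|G3|)%N.
Hypothesis r1_gt0 : (0 < r1)%N.
Hypothesis reg1 : regular G1 r1.
Hypothesis reg2 : regular G2 r2.
Hypothesis reg3 : regular G3 r3.
Variables theta mu eta : seq R.
Hypothesis htheta : norm_laplacian_spectrum G1 theta.
Hypothesis hmu : norm_laplacian_spectrum G2 mu.
Hypothesis heta : norm_laplacian_spectrum G3 eta.
Let P := {poly R}.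
Let S := subdivision G1.

Lemma fdet_copy (K : sgraph) (r c : nat) (s : seq R) :
  (0 < #|K|)%N -> regular K r -> norm_laplacian_spectrum K s ->
  fdet (fun x y : K => c%:R *+ (x == y) + lap P x y) =
  (c%:R * \prod_(j < #|K| - 1) (c%:R + r%:R * s`_j))%:P.
Proof.
move=> K0 reg hs; have := fdet_spectrum_split reg hs c%:R 1 K0.
under eq_fdet do rewrite mul1r.
move=> ->; rewrite polyCM polyC_natr rmorph_prod /=; congr (_ * _).
by apply: eq_bigr => j _; rewrite mul1r rmorphD /= polyC_natr.
Qed.

Lemma degree_inl v : @degree S (inl v) = r1.
Proof.
apply/eqP; rewrite -(eqr_nat R) degree_sum big_sumType /= big1 // add0r.
by rewrite (sum_incident1 _ v) reg1.
Qed.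

Lemma degree_inr e : @degree S (inr e) = 2.
Proof.
apply/eqP; rewrite -(eqr_nat R) degree_sum big_sumType /=.
by rewrite sum_endpoints big1 // addr0.
Qed.

Let att (v : G1) (e : edge G1) : P := (v \in val e)%:R.

Lemma sum_inr e : \sum_b ((inr e : S) == inr b)%:R = 1 :> P.
Proof.
transitivity (1 * 1 : P); last exact: mulr1.
rewrite -(sum_delta e 1 (fun=> 1)); apply: eq_bigr => f _.
by rewrite inr_eqE mulr1.
Qed.

Lemma sum_inr2 e f :
  \sum_b ((inr e : S) == inr b)%:R * ((inr f : S) == inr b)%:R
  = (e == f)%:R :> P.
Proof.
rewrite [e == f]eq_sym -[RHS]mul1r -(sum_delta e 1 (fun b => (f == b)%:R)).
by apply: eq_bigr => b _; rewrite !inr_eqE.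
Qed.

Lemma sum_inl v : \sum_b ((inl v : S) == inl b)%:R = 1 :> P.
Proof.
transitivity (1 * 1 : P); last exact: mulr1.
rewrite -(sum_delta v 1 (fun=> 1)); apply: eq_bigr => w _.
by rewrite inl_eqE mulr1.
Qed.

Lemma sum_inl2 v w :
  \sum_b ((inl v : S) == inl b)%:R * ((inl w : S) == inl b)%:R
  = (v == w)%:R :> P.
Proof.
rewrite [v == w]eq_sym -[RHS]mul1r -(sum_delta v 1 (fun b => (w == b)%:R)).
by apply: eq_bigr => b _; rewrite !inl_eqE.
Qed.

(** After the copies are eliminated, the block of the original vertices is still
    the scalar r1, so they can be eliminated too. *)
Lemma core_vertexE :
  fdet (@core_mx S G1 (edge G1) G2 G3 (fun s v => adj (inl v : S) s)
     (fun s e => s == inr e) R r1 1 (fun s => if s is inr _ then 'X else 0)) =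
  fdet (fun e f : edge G1 => ('X + (2 * (1 + #|G2|))%:R) *+ (e == f)
      - ((1 + #|G2|)%:R * r1%:R^-1) * \sum_v att v e * att v f)
  * r1%:R ^+ #|G1|.
Proof.
set A := core_mx _ _ _ _ _ _ _.
have Avv v v' : A (inl v) (inl v') = r1%:R *+ (v == v').
  rewrite /A /core_mx /lap degree_inl inl_eqE /=.
  do 4![rewrite big1; last by move=> ? _; rewrite ?mul0r].
  by rewrite !mulr0 !subr0 !addr0 mul0rn addr0.
have Ave v e : A (inl v) (inr e) = - att v e.
  rewrite /A /core_mx /lap /=.
  do 4![rewrite big1; last by move=> ? _; rewrite ?mul0r].
  by rewrite !mulr0 !subr0 !addr0 !mulr0n sub0r ?addr0.
have Aev e v : A (inr e) (inl v) = - att v e.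
  rewrite /A /core_mx /lap /=.
  by rewrite -!mulr_suml !mulr0 !subr0 !mulr0n sub0r addr0.
have Aee e f : A (inr e) (inr f) =
   ('X + (2 * (1 + #|G2|))%:R) *+ (e == f)
     - (#|G2|%:R * r1%:R^-1) * \sum_v att v e * att v f.
  rewrite /A /core_mx /lap degree_inr inr_eqE /= sum_endpoints.
  rewrite sum_inr sum_inr2 invr1 !mulr1 subr0 -mulrnDl.
  by case: (e == f); rewrite ?mulr1n ?mulr0n; ring.
have r1U : (r1%:R : P) \is a GRing.unit by apply: natr_poly_unit.
rewrite (@fdet_eliml _ _ _ _ (fun v e => - (r1%:R^-1 * att v e))) => [|v e].
  congr (_ * _).
    apply: eq_fdet => e f; rewrite Aee -addrA -opprD; congr (_ - _).
    under [X in _ + X]eq_bigr do rewrite Aev mulrNN mulrCA.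
    by rewrite -mulr_sumr natrD !mulrDl mul1r addrC.
  rewrite -fdet_scalar; exact: eq_fdet.
rewrite Ave; under eq_bigr do rewrite Avv.
by rewrite sum_delta mulrN mulVKr.
Qed.

(** Here the inserted vertices, of degree 2, are the ones with a scalar block. *)
Lemma core_edgeE :
  fdet (@core_mx S (edge G1) G1 G2 G3 (fun s e => adj (inr e : S) s)
     (fun s v => s == inl v) R 2 1 (fun s => if s is inl _ then 'X else 0)) =
  fdet (fun v w : G1 => ('X + (r1 * (1 + #|G2|))%:R) *+ (v == w)
      - ((1 + #|G2|)%:R * 2^-1) * \sum_e att v e * att w e)
  * 2 ^+ #|edges G1|.
Proof.
set A := core_mx _ _ _ _ _ _ _.
have Aee e f : A (inr e) (inr f) = 2 *+ (e == f).
  rewrite /A /core_mx /lap degree_inr inr_eqE /=.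
  do 4![rewrite big1; last by move=> ? _; rewrite ?mul0r].
  by rewrite !mulr0 !subr0 !addr0 mul0rn addr0.
have Aev v e : A (inr e) (inl v) = - att v e.
  rewrite /A /core_mx /lap /=.
  do 4![rewrite big1; last by move=> ? _; rewrite ?mul0r].
  by rewrite !mulr0 !subr0 !addr0 !mulr0n sub0r ?addr0.
have Ave e v : A (inl v) (inr e) = - att v e.
  rewrite /A /core_mx /lap /=.
  by rewrite -!mulr_suml !mulr0 !subr0 !mulr0n sub0r addr0.
have Avv v w : A (inl v) (inl w) =
   ('X + (r1 * (1 + #|G2|))%:R) *+ (v == w)
     - (#|G2|%:R * 2^-1) * \sum_e att v e * att w e.
  rewrite /A /core_mx /lap degree_inl inl_eqE /= sum_incident1 reg1.
  rewrite sum_inl sum_inl2 invr1 !mulr1 subr0 -mulrnDl.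
  by case: (v == w); rewrite ?mulr1n ?mulr0n; ring.
have U2 : (2 : P) \is a GRing.unit by apply: (@natr_poly_unit _ 2).
rewrite (@fdet_elimr _ _ _ _ (fun e v => - (2^-1 * att v e))) => [|e v].
  congr (_ * _).
    apply: eq_fdet => v w; rewrite Avv -addrA -opprD; congr (_ - _).
    under [X in _ + X]eq_bigr do rewrite Ave mulrNN mulrCA.
    by rewrite -mulr_sumr natrD !mulrDl mul1r addrC.
  rewrite -card_edge -fdet_scalar; exact: eq_fdet.
rewrite Aev; under eq_bigr do rewrite Aee.
by rewrite sum_delta mulrN mulVKr.
Qed.

(** Since B B^T = 2 r1 - L(G1), the diagonal term 2 b r1 cancels. *)
Lemma fdet_incidence (b : R) :
  fdet (fun v w : G1 => ('X + (2 * b * r1%:R)%:P) *+ (v == w)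
      - b%:P * \sum_e att v e * att w e) =
  'X * \prod_(i < #|G1| - 1) ('X + (b * r1%:R * theta`_i)%:P).
Proof.
rewrite -(fdet_spectrum_split reg1 htheta 'X b n1_gt0).
apply: eq_fdet => v w; rewrite sum_incident2 /lap reg1 -(polyC_natr _ r1).
by rewrite !polyCM polyC_natr; case: (v == w); rewrite ?mulr1n ?mulr0n; ring.
Qed.

Lemma coef0_prod n (p : 'I_n -> P) : (\prod_(i < n) p i)`_0 = \prod_(i < n) (p i)`_0.
Proof.
rewrite -horner_coef0 horner_prod.
by apply: eq_bigr => i _; rewrite horner_coef0.
Qed.

(** In degree 0 the hypothesis gives D`_0 = 0, so in degree 1 only D`_1 survives
    on the left. *)
Lemma coef1_cancel (a : R) (m n k : nat) (D : P) (x : 'I_k -> R) :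
  a != 0 ->
  ('X + a%:P) ^+ n * D = ('X + a%:P) ^+ m * ('X * \prod_(i < k) ('X + (x i)%:P)) ->
  D`_1 * a ^+ n = a ^+ m * \prod_(i < k) x i.
Proof.
move=> a0 E.
have aE j : (('X + a%:P) ^+ j)`_0 = a ^+ j.
  by rewrite -horner_coef0 horner_exp !hornerE.
have D0 : D`_0 = 0.
  have /polyP/(_ 0%N) := E; rewrite !coef0M aE coefX mul0r mulr0 => /eqP.
  by rewrite mulf_eq0 expf_eq0 (negPf a0) andbF => /eqP.
have /polyP/(_ 1%N) := E; rewrite mulrCA coefXM /= coef0M aE coef0_prod.
rewrite coefM 2!big_ord_recl big_ord0 /= D0 mulr0 !addr0 subn0 aE mulrC => ->.
congr (_ * _); apply: eq_bigr => i _.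
by rewrite coefD coefX coefC add0r.
Qed.

Let n1 := #|G1|. Let n2 := #|G2|. Let n3 := #|G3|. Let m1 := #|edges G1|.

Theorem vertex_corona_trees :
  (m1 * num_spanning_trees (vertex_corona G1 G2 G3))%:R * (2 * (1 + n2))%:R ^+ n1 =
  (2 * (1 + n2))%:R ^+ m1
  * (\prod_(i < n1 - 1) ((1 + n2)%:R * theta`_i))
  * r1%:R ^+ n1
  * (r1%:R * \prod_(j < n2 - 1) (r1%:R + r2%:R * mu`_j)) ^+ n1
  * (\prod_(k < n3 - 1) (1 + r3%:R * eta`_k)) ^+ m1 :> R.
Proof.
pose X := vertex_corona G1 G2 G3.
pose C : pred X := fun x => if x is inl (inl (inr _)) then true else false.
have cardC : #|C| = m1.
  rewrite /m1 -card_edge -(card_codom (f := fun e : edge G1 => inl (inl (inr e)) : X)).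
    apply: eq_card => x; apply/idP/codomP => [|[e ->] //].
    by case: x => [[[v|e]|a]|b] //; exists e.
  by move=> e f [].
have := @matrix_tree X R C; rewrite cardC => <-.
have -> : fdet (fun x y : X => lap P x y + (if C x then 'X else 0) *+ (x == y))
  = fdet (fun x y : X => lap P x y + (if x is inl (inl h) then
       (if h is inr _ then 'X else 0) else 0) *+ (x == y)).
  by apply: eq_fdet; case=> [[[v|e]|a]|b] y.
rewrite (@fdet_attach S G1 (edge G1) G2 G3 _ _ R r1 1); first last.
- by move=> e; rewrite (eq_card (B := pred1 (inr e))) ?card1.
- move=> v; rewrite -(degree_inl v).
  by apply: eq_card => h; rewrite !inE.
- by [].
- by [].
rewrite core_vertexE (fdet_copy _ n2_gt0 reg2 hmu) (fdet_copy _ n3_gt0 reg3 heta).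
have -> : (r1%:R : P) ^+ #|G1| = (r1%:R ^+ n1)%:P.
  by rewrite polyC_exp polyC_natr.
rewrite mul1r card_edge -!polyC_exp !coefMC.
set D := fdet _.
have D1 : D`_1 * (2 * (1 + n2))%:R ^+ n1 = (2 * (1 + n2))%:R ^+ m1
  * (\prod_(i < n1 - 1) ((1 + n2)%:R * theta`_i)).
  have bE : (1 + #|G2|)%:R / r1%:R = ((1 + n2)%:R / r1%:R)%:P :> P.
    by rewrite polyCM -polyCV !polyC_natr.
  (* This constant is 2 b r1 for b = (1 + n2) / r1, as [fdet_incidence] requires. *)
  have aE : (2 * (1 + n2))%:R = (2 * ((1 + n2)%:R / r1%:R) * r1%:R)%:P :> P.
    by rewrite -mulrA divfK ?pnatr_eq0 -?lt0n // polyCM !polyC_natr -natrM.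
  have : ('X + (2 * (1 + n2))%:R) ^+ n1 * D = ('X + (2 * (1 + n2))%:R) ^+ m1 *
     ('X * \prod_(i < n1 - 1) ('X + ((1 + n2)%:R / r1%:R * r1%:R * theta`_i)%:P)).
    by rewrite -fdet_incidence -aE -bE /m1 -card_edge; apply: fdet_sylvester.
  rewrite divfK ?pnatr_eq0 -?lt0n // -(polyC_natr _ (2 * (1 + n2))).
  apply: coef1_cancel; rewrite ?pnatr_eq0 //.
by rewrite -D1 -!mulrA; congr (_ * _); rewrite [RHS]mulrC !mulrA.
Qed.

Theorem edge_corona_trees :
  (n1 * num_spanning_trees (edge_corona G1 G2 G3))%:R =
  \prod_(i < n1 - 1) ((1 + n2)%:R / 2 * r1%:R * theta`_i)
  * 2 ^+ m1
  * (2 * \prod_(j < n2 - 1) (2 + r2%:R * mu`_j)) ^+ m1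
  * (\prod_(k < n3 - 1) (1 + r3%:R * eta`_k)) ^+ n1 :> R.
Proof.
pose X := edge_corona G1 G2 G3.
pose C : pred X := fun x => if x is inl (inl (inl _)) then true else false.
have cardC : #|C| = n1.
  rewrite /n1 -(card_codom (f := fun v : G1 => inl (inl (inl v)) : X)).
    apply: eq_card => x; apply/idP/codomP => [|[e ->] //].
    by case: x => [[[v|e]|a]|b] //; exists v.
  by move=> e f [].
have := @matrix_tree X R C; rewrite cardC => <-.
have -> : fdet (fun x y : X => lap P x y + (if C x then 'X else 0) *+ (x == y))
  = fdet (fun x y : X => lap P x y + (if x is inl (inl h) then
       (if h is inl _ then 'X else 0) else 0) *+ (x == y)).
  by apply: eq_fdet; case=> [[[v|e]|a]|b] y.
rewrite (@fdet_attach S (edge G1) G1 G2 G3 _ _ R 2 1); first last.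
- by move=> v; rewrite (eq_card (B := pred1 (inl v))) ?card1.
- move=> e; transitivity (@degree S (inr e)); last exact: degree_inr.
  by apply: eq_card => h; rewrite !inE.
- by [].
- by [].
rewrite core_edgeE (fdet_copy _ n2_gt0 reg2 hmu) (fdet_copy _ n3_gt0 reg3 heta).
have -> : (2 : P) ^+ #|edges G1| = (2 ^+ m1)%:P.
  by rewrite polyC_exp polyC_natr.
rewrite mul1r card_edge -!polyC_exp !coefMC; do 3!congr (_ * _).
have -> : (1 + #|G2|)%:R / 2 = ((1 + n2)%:R / 2)%:P :> P.
  by rewrite polyCM -polyCV !polyC_natr.
have -> : (r1 * (1 + #|G2|))%:R = (2 * ((1 + n2)%:R / 2) * r1%:R)%:P :> P.
  by rewrite mulrCA divff ?pnatr_eq0 // mulr1 -natrM mulnC polyC_natr.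
rewrite fdet_incidence coefXM /= coef0_prod; apply: eq_bigr => i _.
by rewrite coefD coefX coefC add0r.
Qed.

End Coronas.

(** * The spanning tree formulas *)


Lemma edges_gt0 (G : sgraph) r :
  regular G r -> (0 < #|G|)%N -> (0 < r)%N -> (0 < #|edges G|)%N.
Proof.
move=> reg n0 r0; rewrite -(ltn_pmul2l (isT : 0 < 2)%N) (handshake reg) muln0.
by rewrite muln_gt0 n0.
Qed.

Lemma expr2z_split (R : numFieldType) (i j : nat) :
  2%:R ^ (i%:Z - j%:Z - 1) = 2 ^+ i / 2 ^+ j / 2 :> R.
Proof.
have two_n0 : 2 != 0 :> R by rewrite pnatr_eq0.
by rewrite !expfzDr // exprnN exprN1.
Qed.

Lemma ratio_eq (R : numFieldType) (N D a b : nat) :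
  (0 < b)%N -> (0 < a)%N -> (0 < D)%N -> (a * D = b * N)%N ->
  N%:R / D%:R = a%:R / b%:R :> R.
Proof.
move=> b0 a0 D0 E; apply/eqP; rewrite eqr_div ?pnatr_eq0 -?lt0n //.
by rewrite -!natrM E mulnC.
Qed.

Theorem theorem4p2 (R : rcfType) (G1 G2 G3 : sgraph)
    (n1 n2 n3 m1 m2 m3 r1 r2 r3 : nat)
    (hn1 : #|G1| = n1) (hn2 : #|G2| = n2) (hn3 : #|G3| = n3)
    (hm1 : #|edges G1| = m1) (hm2 : #|edges G2| = m2) (hm3 : #|edges G3| = m3)
    (n1_ge1 : (1 <= n1)%N) (n2_ge1 : (1 <= n2)%N) (n3_ge1 : (1 <= n3)%N)
    (reg1 : regular G1 r1) (reg2 : regular G2 r2) (reg3 : regular G3 r3)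
    (r1_ge1 : (1 <= r1)%N)
    (theta mu eta : seq R)
    (htheta : norm_laplacian_spectrum G1 theta)
    (hmu : norm_laplacian_spectrum G2 mu)
    (heta : norm_laplacian_spectrum G3 eta) :
  (num_spanning_trees (vertex_corona G1 G2 G3))%:R =
    (\prod_(i < n1 - 1) theta`_i)
    * (\prod_(j < n2 - 1) (r1%:R + r2%:R * mu`_j) ^+ n1)
    * (\prod_(k < n3 - 1) (1 + r3%:R * eta`_k) ^+ m1)
    * r1%:R ^+ (2 * n1 - 1) * (1 + n2%:R) ^+ (m1 - 1)
    * 2%:R ^ (m1%:Z - n1%:Z - 1)
    * ((n3 * r1 * r3 + 4 * n2 * r1 + 2 * n2 * r2 + 2 * n3 * r1 + 4 * r1)%:R
       / (2 * m1 + n1 * m2 + m1 * m3 + 2 * m1 * n2 + m1 * n3)%:R)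
  /\
  (num_spanning_trees (edge_corona G1 G2 G3))%:R =
    2%:R ^ (2 * m1%:Z - n1%:Z - 1)
    * (\prod_(i < n1 - 1) ((r1%:R + r1%:R * n2%:R) * theta`_i))
    * (\prod_(j < n2 - 1) (2 + r2%:R * mu`_j) ^+ m1)
    * (\prod_(k < n3 - 1) (1 + r3%:R * eta`_k) ^+ n1)
    * ((n2 * r1 * r2 + 4 * n2 * r1 + 2 * n3 * r3 + 4 * n3 + 4 * r1)%:R
       / (2 * m1 + m1 * m2 + n1 * m3 + n1 * n3 + 2 * m1 * n2)%:R).
Proof.
have h1 := handshake reg1; have h2 := handshake reg2; have h3 := handshake reg3.
have N1 : (0 < #|G1|)%N by rewrite hn1.
have N2 : (0 < #|G2|)%N by rewrite hn2.
have N3 : (0 < #|G3|)%N by rewrite hn3.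
have M1 := edges_gt0 reg1 N1 r1_ge1.
have V := vertex_corona_trees N1 N2 N3 r1_ge1 reg1 reg2 reg3 htheta hmu heta.
have E := edge_corona_trees N1 N2 N3 reg1 reg2 reg3 htheta hmu heta.
rewrite !hn1 !hn2 !hn3 !hm1 ?hm2 ?hm3 in V E h1 h2 h3 M1.
have n0 k : (0 < k)%N -> k%:R != 0 :> R by rewrite pnatr_eq0 -lt0n.
have two0 : 2 != 0 :> R by rewrite pnatr_eq0.
split.
  (* The last factor is 2 r1 / m1 by the handshake lemma in G1, G2 and G3. *)
  rewrite (@ratio_eq _ _ _ (2 * r1) m1) //; [|lia|lia|]; last first.
    have e2 : (n1 * r1 * (2 * m2) = 2 * m1 * (n2 * r2))%N by rewrite h1 h2.
    have e3 : (r1 * m1 * (2 * m3) = r1 * m1 * (n3 * r3))%N by rewrite h3.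
    nia.
  rewrite expr2z_split !prodrXl -[1 + n2%:R](natrD _ 1 n2).
  move: V; rewrite !natrM big_split /= prodr_const card_ord.
  set a := \prod_(_ < _) _; set b := \prod_(_ < _) _; set c := \prod_(_ < _) _.
  set t := (num_spanning_trees _)%:R => V.
  have {}V : t * (m1%:R * (2 * (1 + n2)%:R) ^+ n1) =
    (2 * (1 + n2)%:R) ^+ m1 * ((1 + n2)%:R ^+ (n1 - 1) * a) * r1%:R ^+ n1
      * (r1%:R * b) ^+ n1 * c ^+ m1.
    by rewrite -V mulrCA mulrA.
  have u0 : (1 + n2)%:R != 0 :> R by rewrite n0.
  move: (n0 _ r1_ge1) (n0 _ M1) u0 V; rewrite !exprMn.
  move: (r1%:R) ((1 + n2)%:R) (m1%:R) => r u m r0 m0 u0.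
  have [[n En] [k Ek]] : (exists n, n1 = n.+1) /\ (exists k, m1 = k.+1).
    by split; [exists n1.-1 | exists m1.-1]; rewrite prednK.
  have -> : (2 * n1 - 1 = n1 + n)%N by lia.
  rewrite exprD En Ek !subn1 /= !exprS => {}V.
  have D0 : m * (2 * 2 ^+ n * (u * u ^+ n)) != 0.
    by rewrite !mulf_neq0 ?expf_neq0.
  apply: (mulIf D0); rewrite V.
  field.
  by rewrite m0 expf_neq0.
(* Likewise the last factor is 4 / n1. *)
- rewrite (@ratio_eq _ _ _ 4 n1) //; [|lia|]; last first.
    have e2 : (m1 * (2 * m2) * 2 = n1 * r1 * (n2 * r2))%N by rewrite -h1 -h2; lia.
    have e3 : (n1 * (2 * m3) = n1 * (n3 * r3))%N by rewrite h3.
    nia.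
  rewrite -[2 * m1%:Z]/((2 * m1)%:Z) expr2z_split !prodrXl.
  have thetaE : \prod_(i < n1 - 1) ((1 + n2)%:R / 2 * r1%:R * theta`_i)
      = 2^-1 ^+ (n1 - 1) * \prod_(i < n1 - 1) ((r1%:R + r1%:R * n2%:R) * theta`_i).
    rewrite -[X in _ ^+ X]card_ord -prodr_const -big_split /=.
    by apply: eq_bigr => i _; rewrite natrD; ring.
  move: E; rewrite thetaE natrM.
  set a := \prod_(_ < _) _; set b := \prod_(_ < _) _; set c := \prod_(_ < _) _.
  set t := (num_spanning_trees _)%:R.
  have [n En] : exists n, n1 = n.+1 by exists n1.-1; rewrite prednK.
  have /n0 := n1_ge1; move: (n1%:R) a b c t => d a b c t d0.
  rewrite mul2n -addnn exprD En subn1 /= !exprMn exprVn !exprS => E.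
  apply: (mulfI d0); rewrite E; field.
  by rewrite d0 expf_neq0.
Qed.
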